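(* For every integer $n\ge 3$, $$t(n)=\left\lceil\log_2(n-1)\right\rceil .$$
   Context: Let $K_n$ be the complete graph on $n$ vertices. An orientation of the edges of $K_n$ chooses for each edge one of its two directions. A triangle is cyclically oriented in an orientation if its three edges form a directed cycle. The number $t(n)$ denotes the minimum number of orientations of the edges of $K_n$ in a family such that every triangle of $K_n$ is cyclically oriented in at least one orientation of the family. *)

(* Defs.v *)
From mathcomp Require Import all_boot all_order all_algebra.
From mathcomp Require Import reals exp.

Set Implicit Arguments.
Unset Strict Implicit.
Unset Printing Implicit Defensive.

Import Order.TTheory GRing.Theory Num.Theory.

Definition is_orientation n (o : {ffun 'I_n * 'I_n -> bool}) : bool :=
  [forall x, ~~ o (x, x)] &&
  [forall x, forall y, (x != y) ==> (o (x, y) (+) o (y, x))].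

Definition orientation n := {o : {ffun 'I_n * 'I_n -> bool} | is_orientation o}.

Definition arc n (o : orientation n) : rel 'I_n := fun x y => val o (x, y).

Definition cyclic_triangle n (o : orientation n) (a b c : 'I_n) : bool :=
  [&& arc o a b, arc o b c & arc o c a] || [&& arc o b a, arc o c b & arc o a c].

Definition covers_triangles n (F : {set orientation n}) : bool :=
  [forall a, forall b, forall c, [&& a != b, b != c & a != c] ==>
    [exists o in F, cyclic_triangle o a b c]].

(* The default family, consisting of all orientations, is never used as a
   fallback, since it is itself admissible: see [covers_trianglesT]. *)
Definition t n : nat :=
  #|[arg min_(F < [set: orientation n] | covers_triangles F) #|F| ]|.

Definition log2 (R : realType) (x : R) : R := (ln x / ln 2)%R.

Lemma covers_trianglesT n : covers_triangles [set: orientation n].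
Proof.
apply/'forall_forallP => a b; apply/forallP => c.
apply/implyP => /and3P[ab bc ac].
pose C := [:: (a, b); (b, c); (c, a)].
pose o := [ffun p : 'I_n * 'I_n =>
  (p \in C) || (((p.2, p.1) \notin C) && (p.1 < p.2))].
have oP : is_orientation o.
  apply/andP; split.
    apply/forallP => x; rewrite ffunE /= ltnn andbF orbF.
    apply/negP; rewrite !inE !xpair_eqE => /or3P[] /andP[/eqP-> ];
    by rewrite 1?(negPf ab) ?(negPf bc) // eq_sym (negPf ac).
  apply/'forall_forallP => x y; apply/implyP => xy; rewrite !ffunE /=.
  have nC : ~~ (((x, y) \in C) && ((y, x) \in C)).
    apply/negP; rewrite !inE !xpair_eqE => /andP[] /or3P[] /andP[/eqP-> /eqP->];
    by rewrite ?eqxx ?(negPf ab) ?(negPf bc) ?(negPf ac)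
        1?eq_sym ?(negPf ab) ?(negPf bc) ?(negPf ac) ?andbF //=
        1?eq_sym ?(negPf ab) ?(negPf bc) ?(negPf ac) ?andbF.
  move: nC; case: (_ \in C); case: (_ \in C) => //= _.
  by case: ltngtP xy => // /val_inj ->; rewrite eqxx.
apply/existsP; exists (Sub o oP : orientation n); rewrite inE /=.
by rewrite /cyclic_triangle /arc /= !ffunE !inE !eqxx !orbT.
Qed.

Lemma t_attained n :
  exists F : {set orientation n}, covers_triangles F /\ #|F| = t n.
Proof.
rewrite /t; case: arg_minnP => [|F covF _]; first exact: covers_trianglesT.
by exists F.
Qed.

Lemma t_min n (F : {set orientation n}) : covers_triangles F -> t n <= #|F|.
Proof.
rewrite /t; case: arg_minnP => [|G _ minG]; first exact: covers_trianglesT.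
exact: minG.
Qed.

(* Main.v *)
Require Import Defs.
From mathcomp Require Import all_boot all_order all_algebra.
From mathcomp Require Import reals exp.
From mathcomp Require Import zify.

(** Both bounds rest on reading a family of [k] orientations as a labelling of
    the arcs by binary vectors of length [k].

    Lower bound ([covers_triangles_card]).  Fix a vertex [v] and send every
    other vertex [u] to the set of orientations in which the edge [vu] leaves
    [v].  If [u] and [w] had the same image, then in every orientation the two
    edges at [v] of the triangle [vuw] would both leave or both enter [v], and
    the triangle would never be cyclic.  The map is thus injective, so
    [n - 1 <= 2 ^ k].

    Upper bound ([t_le]).  When [n - 1 <= 2 ^ k], number the vertices
    [0, ..., n - 1] and orient [a < b] in the [i]-th orientation according to
    the [i]-th binary digit of [b - a - 1], which is smaller than [2 ^ k].  For
    [a < b < c] with [x = b - a - 1] and [y = c - b - 1], one has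
    [c - a - 1 = x + y + 1], and the triangle is cyclic as soon as some digit is
    0 in both [x] and [y] but 1 in [x + y + 1].  Such a digit exists
    ([carry_absorbed]): the extra 1 acts as an incoming carry at position 0, and
    a carry survives a position unless both digits there are 0.  Since
    [x + y + 1 < 2 ^ k] has no digit at position [k], the carry stops at some
    position below [k], and there it is written into the sum.

    Hence [t n] is the least [k] with [n - 1 <= 2 ^ k], which is the rounded-up
    binary logarithm. *)

Set Implicit Arguments.
Unset Strict Implicit.
Unset Printing Implicit Defensive.

(* This makes [arc] the arc relation of an orientation, instead of the subpath
   of a cyclic sequence. *)
Import Defs.
Import Order.TTheory GRing.Theory Num.Theory.

(** * Binary digits *)

Definition bit (i m : nat) : bool := odd (m %/ 2 ^ i).

Lemma bit0 m : bit 0 m = odd m.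
Proof. by rewrite /bit divn1. Qed.

Lemma bitS i m : bit i.+1 m = bit i m./2.
Proof. by rewrite /bit expnS divnMA divn2. Qed.

(** The carry that enters at position 0 must stop before position [k], and the
    digit 0 + 0 where it stops becomes 1.  The induction peels off the lowest
    digit: if it does not stop the carry, the halves satisfy the same
    hypothesis. *)
Lemma carry_absorbed k x y : x + y + 1 < 2 ^ k ->
  exists i : 'I_k, [/\ ~~ bit i x, ~~ bit i y & bit i (x + y + 1)].
Proof.
elim: k x y => [|k IHk] x y; first by rewrite addn1.
rewrite expnS => xy_lt.
have [/andP[x_even y_even]|one_odd] := boolP (~~ odd x && ~~ odd y).
  exists ord0; rewrite !bit0; split=> //.
  by rewrite !oddD (negPf x_even) (negPf y_even).
have halfD : (x + y + 1)./2 = x./2 + y./2 + 1.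
  by move: one_odd; have := odd_double_half x; have := odd_double_half y; lia.
have [|i [ix iy ixy]] := IHk x./2 y./2; first by rewrite -halfD; lia.
by exists (lift ord0 i); rewrite !bitS halfD.
Qed.

(** * Orienting edges by the digits of the differences *)

Section DigitOrientation.
Variable n : nat.

Definition digit_arcs i : {ffun 'I_n * 'I_n -> bool} :=
  [ffun p : 'I_n * 'I_n =>
    if p.1 < p.2 then bit i (p.2 - p.1).-1
    else (p.2 < p.1) && ~~ bit i (p.1 - p.2).-1].

Lemma digit_arcsP i : is_orientation (digit_arcs i).
Proof.
apply/andP; split; first by apply/forallP => x; rewrite ffunE /= ltnn.
apply/'forall_forallP => x y; apply/implyP => xy; rewrite !ffunE /=.
by case: ltngtP xy => [_|_|/val_inj->]; [case: bit|case: bit|rewrite eqxx].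
Qed.

Definition digit_orientation i : orientation n := Sub _ (digit_arcsP i).

Lemma arc_digit_lt i (a b : 'I_n) : a < b ->
  arc (digit_orientation i) a b = bit i (b - a).-1.
Proof. by move=> ab; rewrite /arc /= ffunE /= ab. Qed.

Lemma arc_digit_gt i (a b : 'I_n) : a < b ->
  arc (digit_orientation i) b a = ~~ bit i (b - a).-1.
Proof. by move=> ab; rewrite /arc /= ffunE /= ab ltnNge ltnW. Qed.

Lemma cyclic_triangleCl (o : orientation n) a b c :
  cyclic_triangle o a b c = cyclic_triangle o b a c.
Proof.
by rewrite /cyclic_triangle orbC [arc o b c && _]andbC [arc o c b && _]andbC.
Qed.

Lemma cyclic_triangleCr (o : orientation n) a b c :
  cyclic_triangle o a b c = cyclic_triangle o a c b.
Proof.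
rewrite /cyclic_triangle orbC.
by congr (_ || _); rewrite andbC -andbA andbCA.
Qed.

Lemma digit_cyclic_sorted k (a b c : 'I_n) : n.-1 <= 2 ^ k -> a < b < c ->
  exists i : 'I_k, cyclic_triangle (digit_orientation i) a b c.
Proof.
move=> nk /andP[ab bc]; have ac := ltn_trans ab bc.
have c_lt := ltn_ord c.
have diffD : (c - a).-1 = (b - a).-1 + (c - b).-1 + 1 by lia.
have [|i [iab ibc iac]] := @carry_absorbed k (b - a).-1 (c - b).-1.
  by rewrite -diffD; lia.
(* Digits 0, 0, 1 put the cycle in the direction a <- b <- c <- a. *)
exists i; apply/orP; right.
by rewrite !(arc_digit_gt _ ab, arc_digit_gt _ bc, arc_digit_lt _ ac)
  iab ibc diffD iac.
Qed.

Lemma digit_cyclic k (a b c : 'I_n) : n.-1 <= 2 ^ k ->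
  a != b -> b != c -> a != c ->
  exists i : 'I_k, cyclic_triangle (digit_orientation i) a b c.
Proof.
move=> nk.
wlog ab : a b / a < b => [wlog_ab|].
  case: (ltngtP a b) => [ab|ba|/val_inj->]; [exact: wlog_ab| |by rewrite eqxx].
  move=> ab bc ac; have [||||i] := wlog_ab b a; rewrite // 1?eq_sym //.
  by exists i; rewrite cyclic_triangleCl.
move=> _ bc ac.
have [bc_lt|cb|/val_inj bc_eq] := ltngtP b c; last by rewrite bc_eq eqxx in bc.
  by apply: digit_cyclic_sorted => //; rewrite ab.
have [ac_lt|ca|/val_inj ac_eq] := ltngtP a c; last by rewrite ac_eq eqxx in ac.
  have [|i] := @digit_cyclic_sorted k a c b nk; first by rewrite ac_lt.
  by exists i; rewrite cyclic_triangleCr.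
have [|i] := @digit_cyclic_sorted k c a b nk; first by rewrite ca.
by exists i; rewrite cyclic_triangleCr cyclic_triangleCl.
Qed.

End DigitOrientation.

Lemma t_le n k : n.-1 <= 2 ^ k -> t n <= k.
Proof.
move=> nk; pose F := [set digit_orientation n i | i : 'I_k].
have F_card : #|F| <= k by rewrite -[leqRHS]card_ord leq_imset_card.
apply: leq_trans F_card; apply: t_min.
apply/'forall_forallP => a b; apply/forallP => c.
apply/implyP => /and3P[ab bc ac].
have [i cyc] := digit_cyclic nk ab bc ac.
by apply/existsP; exists (digit_orientation n i); rewrite imset_f.
Qed.

(** * Counting out-directions at a vertex *)

Lemma arcC n (o : orientation n) x y : x != y -> arc o y x = ~~ arc o x y.
Proof.
move=> xy; have /andP[_ /'forall_forallP/(_ x y)] := valP o.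
by rewrite xy /arc /=; case: (val o (x, y)); case: (val o (y, x)).
Qed.

Lemma cyclic_triangle_arc n (o : orientation n) v u w :
  v != u -> v != w -> cyclic_triangle o v u w -> arc o v u != arc o v w.
Proof.
move=> vu vw; rewrite /cyclic_triangle (arcC _ vu) (arcC _ vw).
by case: (arc o v u); case: (arc o v w); rewrite ?andbF.
Qed.

(** Sets of orientations in [F] are the possible out-directions of the edges at
    [v]; a triangle through [v] is never cyclic when its two other vertices
    receive the same set. *)
Lemma covers_triangles_card n (F : {set orientation n}) :
  covers_triangles F -> n.-1 <= 2 ^ #|F|.
Proof.
case: n F => [|n] F //.
move=> /'forall_forallP covF; pose v : 'I_n.+1 := ord0.
pose out u := [set o in F | arc o v u].
have out_inj : {in [set~ v] &, injective out}.
  move=> u w; rewrite !inE eq_sym => vu; rewrite eq_sym => vw out_eq.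
  apply/eqP/negPn/negP => uw.
  have /forallP/(_ w) := covF v u; rewrite vu uw vw /= => /existsP[o].
  case/andP=> oF /(cyclic_triangle_arc vu vw)/negP[]; apply/eqP.
  by have /setP/(_ o) := out_eq; rewrite !inE oF.
rewrite -card_powerset -[n.+1.-1](card_ord n.+1.-1).
have -> : #|'I_n.+1.-1| = #|[set~ v]| by rewrite cardsC1 !card_ord.
rewrite -(card_in_imset out_inj); apply: subset_leq_card.
apply/subsetP => _ /imsetP[u _ ->]; rewrite inE.
by apply/subsetP => o /setIdP[].
Qed.

Lemma t_up_log n : t n = up_log 2 n.-1.
Proof.
apply/eqP; rewrite eqn_leq t_le ?up_logP //=; apply: up_log_min => //.
by have [F [/covers_triangles_card covF <-]] := t_attained n.
Qed.

(** * The real logarithm *)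

Lemma ln2_gt0 (R : realType) : (0 < ln (2 : R))%R.
Proof. by rewrite ln_gt0 // ltr1n. Qed.

Lemma log2_le_nat (R : realType) (m k : nat) : 0 < m ->
  (log2 (m%:R : R) <= k%:R)%R = (m <= 2 ^ k).
Proof.
move=> m_gt0; rewrite /log2 ler_pdivrMr ?ln2_gt0 // mulr_natl -lnXn //.
by rewrite ler_ln ?posrE ?exprn_gt0 ?ltr0n // -natrX ler_nat.
Qed.

Lemma ceil_log2 (R : realType) (m : nat) : 0 < m ->
  Num.ceil (log2 (m%:R : R)) = up_log 2 m.
Proof.
move=> m_gt0.
have log2_ge0 : (0 <= log2 (m%:R : R))%R.
  by rewrite divr_ge0 ?ln_ge0 ?ler1n ?(ltW (ln2_gt0 R)).
have ceil_ge0 : (0 <= Num.ceil (log2 (m%:R : R)))%R.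
  by rewrite ceil_ge0 (lt_le_trans _ log2_ge0) ?ltrN10.
case ceilE: (Num.ceil _) ceil_ge0 => [k|//] _; congr Posz.
have k_le j : (k <= j) = (m <= 2 ^ j).
  by rewrite -(log2_le_nat R) // -[j%:R%R]/(j%:~R)%R -ceil_le_int ceilE.
by apply/eqP; rewrite eqn_leq k_le up_logP //= up_log_min // -k_le.
Qed.

Theorem corollary1 (R : realType) (n : nat) (hn : 3 <= n) :
  Posz (t n) = Num.ceil (log2 (n%:R - 1 : R)%R).
Proof.
have n_gt0 : 0 < n by exact: leq_trans hn.
rewrite -(natrB R n_gt0) subn1 ceil_log2 ?t_up_log //.
by rewrite -subn1 subn_gt0; exact: leq_trans hn.
Qed.
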